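(* Let $H$ be a bialgebra over a field $K$, let $A$ be an $H$-module-algebra with action map $\lambda$, and let $\Lambda_t=\sum_{i=0}^N\lambda_it^i$ be a deformation of $A$ of order $N\ge1$. Then the $2$-cochain $$\mathrm{Ob}=\sum_{i=1}^N\lambda_i\cup\lambda_{N+1-i}\in\mathcal{F}^2(A)$$ is a $2$-cocycle, i.e. $d^2\,\mathrm{Ob}=0$.
   Context: Fix a field $K$; $\otimes$ and $\mathrm{Hom}$ are over $K$. $(H,\mu_H,\Delta_H)$ is a $K$-bialgebra; Sweedler notation $\Delta_H(x)=\sum_{(x)} x_{(1)}\otimes x_{(2)}$. $\mathrm{End}(A)$ is the algebra of $K$-linear endomorphisms of $A$. An associative $K$-algebra $A$ is an $H$-module-algebra if it has an $H$-module structure $\lambda\in\mathrm{Hom}(H,\mathrm{End}(A))$ with $\lambda(xy)=\lambda(x)\circ\lambda(y)$ and $\lambda(x)(ab)=\sum_{(x)}\lambda(x_{(1)})(a)\cdot\lambda(x_{(2)})(b)$ for $x,y\in H$, $a,b\in A$. Cochains: $\mathcal{F}^1(A)=\mathrm{Hom}(H,\mathrm{End}(A))$, and for $n\ge2$, $\mathcal{F}^n(A)=\mathrm{Hom}(H^{\otimes n},\mathrm{End}(A))\oplus\mathrm{Hom}(H,\mathrm{Hom}(A^{\otimes n},A))$, with elements written $(\varphi_0;\varphi_1)$; the differential is $d^n(\varphi_0;\varphi_1)=(d^n_0\varphi_0;d^n_1\varphi_1)$, where $$(d^n_0\varphi_0)(x_1\otimes\cdots\otimes x_{n+1})=\lambda(x_1)\circ\varphi_0(x_2\otimes\cdots\otimes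 x_{n+1})+\sum_{i=1}^n(-1)^i\varphi_0(x_1\otimes\cdots\otimes x_ix_{i+1}\otimes\cdots\otimes x_{n+1})+(-1)^{n+1}\varphi_0(x_1\otimes\cdots\otimes x_n)\circ\lambda(x_{n+1}),$$ $$(d^n_1\varphi_1)(x)(a_1\otimes\cdots\otimes a_{n+1})=\sum_{(x)}\lambda(x_{(1)})(a_1)\cdot\varphi_1(x_{(2)})(a_2\otimes\cdots\otimes a_{n+1})+\sum_{i=1}^n(-1)^i\varphi_1(x)(a_1\otimes\cdots\otimes a_ia_{i+1}\otimes\cdots\otimes a_{n+1})+(-1)^{n+1}\sum_{(x)}\varphi_1(x_{(1)})(a_1\otimes\cdots\otimes a_n)\cdot\lambda(x_{(2)})(a_{n+1}).$$ For $n=1$, $\varphi_0=\varphi_1=\varphi$. Cup-product of $f,g\in\mathcal{F}^1(A)$: $f\cup g=((f\cup g)_0;(f\cup g)_1)\in\mathcal{F}^2(A)$ with $(f\cup g)_0(x\otimes y)=f(x)\circ g(y)$ and $(f\cup g)_1(x)(a\otimes b)=\sum_{(x)}f(x_{(1)})(a)\cdot g(x_{(2)})(b)$. A deformation of order $N$ of $A$ is a polynomial $\Lambda_t=\sum_{i=0}^N\lambda_it^i$ with $\lambda_0=\lambda$, each $\lambda_i\in\mathcal{F}^1(A)$, such that for all $0\le n\le N$, $x,y\in H$, $a,b\in A$: $\lambda_n(xy)=\sum_{i+j=n}\lambda_i(x)\circ\lambda_j(y)$ and $\lambda_n(x)(ab)=\sum_{(x)}\sum_{i+j=n}\lambda_i(x_{(1)})(a)\cdot\lambda_j(x_{(2)})(b)$.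 *)

(* Defs.v *)
From HB Require Import structures.
From mathcomp Require Import freeg.
From mathcomp Require Import all_boot all_algebra.
From mathcomp Require Import boolp.

Set Implicit Arguments.
Unset Strict Implicit.
Unset Printing Implicit Defensive.

Import GRing.Theory.
Local Open Scope ring_scope.
Local Open Scope quotient_scope.

Section LinearMaps.
Variables (K : fieldType) (U V : lmodType K).
Implicit Types f g h : {linear U -> V}.

Lemma linear_ext f g : f =1 g -> f = g.
Proof.
case: f => f [[f1] [f2]]; case: g => g [[g1] [g2]] /= /funext efg.
by subst g; rewrite (Prop_irrelevance f1 g1) (Prop_irrelevance f2 g2).
Qed.

HB.instance Definition _ := gen_eqMixin {linear U -> V}.
HB.instance Definition _ := gen_choiceMixin {linear U -> V}.

Definition lzero : {linear U -> V} := \0.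
Definition ladd f g : {linear U -> V} := f \+ g.
Definition lopp f : {linear U -> V} := \- f.
Definition lscale (c : K) f : {linear U -> V} := c \*: f.

Fact laddA : associative ladd.
Proof. by move=> f g h; apply: linear_ext => x /=; rewrite addrA. Qed.
Fact laddC : commutative ladd.
Proof. by move=> f g; apply: linear_ext => x /=; rewrite addrC. Qed.
Fact ladd0 : left_id lzero ladd.
Proof. by move=> f; apply: linear_ext => x /=; rewrite add0r. Qed.
Fact laddN : left_inverse lzero lopp ladd.
Proof. by move=> f; apply: linear_ext => x /=; rewrite addNr. Qed.

HB.instance Definition _ :=
  GRing.isZmodule.Build {linear U -> V} laddA laddC ladd0 laddN.

Fact lscaleA c d f : lscale c (lscale d f) = lscale (c * d) f.
Proof. by apply: linear_ext => x /=; rewrite scalerA. Qed.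
Fact lscale1 : left_id 1 lscale.
Proof. by move=> f; apply: linear_ext => x /=; rewrite scale1r. Qed.
Fact lscaleDr : right_distributive lscale +%R.
Proof. by move=> c f g; apply: linear_ext => x /=; rewrite scalerDr. Qed.
Fact lscaleDl f : {morph lscale^~ f : c d / c + d}.
Proof. by move=> c d; apply: linear_ext => x /=; rewrite scalerDl. Qed.

HB.instance Definition _ :=
  GRing.Zmodule_isLmodule.Build K {linear U -> V}
    lscaleA lscale1 lscaleDr lscaleDl.

Lemma linD_apply f g x : (f + g : {linear U -> V}) x = f x + g x.
Proof. by []. Qed.
Lemma linN_apply f x : (- f : {linear U -> V}) x = - f x.
Proof. by []. Qed.
Lemma linZ_apply c f x : (c *: f : {linear U -> V}) x = c *: f x.
Proof. by []. Qed.
Lemma lin0_apply x : (0 : {linear U -> V}) x = 0.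
Proof. by []. Qed.
Lemma lin_sum_apply I (r : seq I) P (F : I -> {linear U -> V}) x :
  (\sum_(i <- r | P i) F i : {linear U -> V}) x = \sum_(i <- r | P i) F i x.
Proof. by elim/big_rec2: _ => // i u v _ <-. Qed.

Definition mk_linear (f : U -> V) (hf : linear f) : {linear U -> V} :=
  HB.pack f (GRing.isLinear.Build K U V *:%R f hf).

Lemma mk_linearE f hf x : @mk_linear f hf x = f x. Proof. by []. Qed.

End LinearMaps.

Definition lcomp (K : fieldType) (U V W : lmodType K)
  (f : {linear V -> W}) (g : {linear U -> V}) : {linear U -> W} := f \o g.

Section TuplesOfVectors.
Variables (T : Type) (n : nat).

Definition tupd (x : n.-tuple T) (i : 'I_n) (a : T) : n.-tuple T :=
  [tuple if j == i then a else tnth x j | j < n].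

Definition ttail (x : n.+1.-tuple T) : n.-tuple T :=
  [tuple tnth x (lift ord0 j) | j < n].

Definition tinit (x : n.+1.-tuple T) : n.-tuple T :=
  [tuple tnth x (lift ord_max j) | j < n].

(* (x_0, .., x_n) |-> (x_0, .., op x_m x_(m+1), .., x_n) *)
Definition tmerge (op : T -> T -> T) (x : n.+1.-tuple T) (m : 'I_n) :
    n.-tuple T :=
  [tuple if (j < m)%N then tnth x (widen_ord (leqnSn n) j)
         else if j == m
         then op (tnth x (widen_ord (leqnSn n) j)) (tnth x (lift ord0 j))
         else tnth x (lift ord0 j) | j < n].

End TuplesOfVectors.

Definition multilinear (K : fieldType) (V W : lmodType K) (n : nat)
    (F : n.-tuple V -> W) : Prop :=
  forall (x : n.-tuple V) (i : 'I_n) (c : K) (a b : V),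
    F (tupd x i (c *: a + b)) = c *: F (tupd x i a) + F (tupd x i b).

Section TensorPower.
Variables (K : fieldType) (V : lmodType K) (n : nat).

Let free_on_tuples := {freeg (n.-tuple V) / K}.
Let gen (x : n.-tuple V) : free_on_tuples := << x >>.

(* The linear span of the multilinearity relations, as the intersection of
   all the subspaces which contain them. *)
Definition tensor_relations : pred free_on_tuples := fun u =>
  `[< forall S : free_on_tuples -> Prop,
        S 0 ->
        (forall (c : K) (v w : free_on_tuples), S v -> S w -> S (c *: v + w)) ->
        (forall (x : n.-tuple V) (i : 'I_n) (c : K) (a b : V),
           S (gen (tupd x i (c *: a + b))
              - (c *: gen (tupd x i a) + gen (tupd x i b)))) ->
        S u >].

Fact tensor_relations_submod : submod_closed tensor_relations.
Proof.
split; first by apply/asboolP.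
move=> c u v /asboolP hu /asboolP hv; apply/asboolP => S S0 SL SR.
by apply: (SL); [apply: (hu) | apply: (hv)].
Qed.

HB.instance Definition _ :=
  GRing.isSubmodClosed.Build K free_on_tuples tensor_relations
    tensor_relations_submod.

Definition tpow : Type :=
  Quotient.quot (GRing.ZmodClosed.clone free_on_tuples tensor_relations _).

HB.instance Definition _ := GRing.Zmodule.on tpow.
HB.instance Definition _ := Quotient.on tpow.

Lemma tpow_eqE (u v : free_on_tuples) :
  (\pi_tpow u = \pi_tpow v) <-> u - v \in tensor_relations.
Proof.
rewrite [u - v \in _]Quotient.idealrBE.
by split=> [/eqP|/eqP].
Qed.

Lemma tpow_piD : {morph \pi_tpow : u v / u + v}.
Proof. exact: Quotient.pi_add. Qed.

Lemma tpow_piN : {morph \pi_tpow : u / - u}.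
Proof. exact: Quotient.pi_opp. Qed.

Definition tscale (c : K) (z : tpow) : tpow := \pi_tpow (c *: repr z).

Lemma tpow_piZ c u : \pi_tpow (c *: u) = tscale c (\pi_tpow u).
Proof.
rewrite /tscale; apply/tpow_eqE; rewrite -scalerBr; apply: rpredZ.
by apply/tpow_eqE; rewrite reprK.
Qed.

Fact tscaleA c d z : tscale c (tscale d z) = tscale (c * d) z.
Proof. by rewrite -[z]reprK -!tpow_piZ scalerA reprK. Qed.
Fact tscale1 : left_id 1 tscale.
Proof. by move=> z; rewrite -[z]reprK -tpow_piZ scale1r. Qed.
Fact tscaleDr : right_distributive tscale +%R.
Proof.
by move=> c y z; rewrite -[y]reprK -[z]reprK -tpow_piD -!tpow_piZ -tpow_piD
  scalerDr.
Qed.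
Fact tscaleDl z : {morph tscale^~ z : c d / c + d}.
Proof. by move=> c d; rewrite -[z]reprK -!tpow_piZ -tpow_piD scalerDl. Qed.

HB.instance Definition _ :=
  GRing.Zmodule_isLmodule.Build K tpow tscaleA tscale1 tscaleDr tscaleDl.

Lemma tpow_piZE c u : \pi_tpow (c *: u) = c *: (\pi_tpow u : tpow).
Proof. exact: tpow_piZ. Qed.

Definition tpure (x : n.-tuple V) : tpow := \pi_tpow (gen x).

Lemma tpure_multilinear : multilinear tpure.
Proof.
move=> x i c a b; rewrite /tpure -tpow_piZE -tpow_piD.
by apply/tpow_eqE/asboolP => S _ _; apply.
Qed.

(* [tsum F z] is the sum of c_k *: F x_k over a chosen expression of z as a
   finite linear combination of pure tensors c_k *: tpure x_k.  When F is
   multilinear this does not depend on the choice: see [tlift]. *)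
Definition tsum (W : lmodType K) (F : n.-tuple V -> W) (z : tpow) : W :=
  fglift F (repr z).

Section Lift.
Variables (W : lmodType K) (F : n.-tuple V -> W).

Fact fglift_linear : linear (fglift F : free_on_tuples -> W).
Proof.
have fgB : additive (fglift F : free_on_tuples -> W) := lift_is_additive F.
have fg0 : fglift F 0 = 0 by rewrite -[X in fglift F X](subrr 0) fgB subrr.
have fgN u : fglift F (- u) = - fglift F u by rewrite -sub0r fgB fg0 sub0r.
have fgD u v : fglift F (u + v) = fglift F u + fglift F v.
  by rewrite -[v in LHS]opprK fgB fgN opprK.
move=> c u v; rewrite fgD; congr (_ + _).
rewrite -[u in RHS]freeg_sumE /GRing.scale /= /fgscale.
elim/big_rec2: _ => [|x a b _ IH]; first by rewrite fg0 [RHS]scaler0.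
by rewrite fgD IH !fgD liftU [in RHS]liftU [RHS]scalerDr scalerA.
Qed.

Fact fglift_gen x : fglift F (gen x) = F x.
Proof. by rewrite liftU scale1r. Qed.

Hypothesis hF : multilinear F.

Lemma tsum_pi u : tsum F (\pi_tpow u) = fglift F u.
Proof.
have hr : repr (\pi_tpow u) - u \in tensor_relations.
  by apply/tpow_eqE; rewrite reprK.
pose g : {linear free_on_tuples -> W} := mk_linear fglift_linear.
apply/eqP; rewrite -subr_eq0 -[_ - _](raddfB g); apply/eqP.
move/asboolP/(_ (fun w => g w = 0)): hr; apply=> [|c v w gv gw|x i c a b]; first exact: raddf0.
  by rewrite linearP gv gw scaler0 addr0.
have gE y : g (gen y) = F y by exact: fglift_gen.
by rewrite linearB linearP !gE hF subrr.
Qed.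

Lemma tsum_pure x : tsum F (tpure x) = F x.
Proof. by rewrite /tpure tsum_pi fglift_gen. Qed.

Lemma tsum_linear : linear (tsum F).
Proof.
move=> c y z; rewrite -[y]reprK -[z]reprK -tpow_piZE -tpow_piD.
by rewrite !tsum_pi fglift_linear.
Qed.

Definition tlift : {linear tpow -> W} := mk_linear tsum_linear.

Lemma tlift_pure x : tlift (tpure x) = F x. Proof. exact: tsum_pure. Qed.

End Lift.

Lemma tsum_linearl (W : lmodType K) (c : K) (F G : n.-tuple V -> W) z :
  tsum (fun x => c *: F x + G x) z = c *: tsum F z + tsum G z.
Proof.
rewrite /tsum.
pose lin h : {linear free_on_tuples -> W} := mk_linear (@fglift_linear W h).
rewrite -[LHS]/(lin _ (repr z)) -[fglift F _]/(lin F _) -[fglift G _]/(lin G _).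
rewrite -[repr z]freeg_sumE !linear_sum -big_split.
apply: eq_bigr => x _.
rewrite -[LHS]/(fglift _ _) -[lin F _]/(fglift F _) -[lin G _]/(fglift G _).
by rewrite !liftU scalerDr /= !scalerA mulrC.
Qed.

Lemma tpow_ext (W : lmodType K) (f g : {linear tpow -> W}) :
  (forall x, f (tpure x) = g (tpure x)) -> f = g.
Proof.
move=> efg; apply: linear_ext => z; rewrite -[z]reprK -[repr z]freeg_sumE.
elim/big_rec: _ => [|x u _ IH].
  have -> : \pi_tpow 0 = 0 :> tpow by rewrite -[0](subrr 0) tpow_piD tpow_piN subrr.
  by rewrite !linear0.
rewrite tpow_piD !linearD IH; congr (_ + _).
have -> : << coeff x (repr z) *g x >> = coeff x (repr z) *: gen x.
  by apply/eqP/freeg_eqP => y; rewrite coeffZ !coeffU mul1r.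
by rewrite tpow_piZE !linearZ /= efg.
Qed.

End TensorPower.

Section Multilinear.
Variables (K : fieldType) (V W : lmodType K).

Lemma multilinear_add n (F G : n.-tuple V -> W) :
  multilinear F -> multilinear G -> multilinear (fun x => F x + G x).
Proof. by move=> hF hG x i c a b; rewrite hF hG scalerDr addrACA. Qed.

Lemma multilinear_scale n d (F : n.-tuple V -> W) :
  multilinear F -> multilinear (fun x => d *: F x).
Proof. by move=> hF x i c a b; rewrite hF scalerDr !scalerA mulrC. Qed.

Lemma multilinear_sum n (I : Type) (r : seq I) (F : I -> n.-tuple V -> W) :
  (forall j, multilinear (F j)) -> multilinear (fun x => \sum_(j <- r) F j x).
Proof.
move=> hF x i c a b; rewrite scaler_sumr -big_split.
by apply: eq_bigr => j _; apply: hF.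
Qed.

Lemma tupd_id n (x : n.-tuple V) i a : tnth (tupd x i a) i = a.
Proof. by rewrite tnth_mktuple eqxx. Qed.

Lemma tupd_neq n (x : n.-tuple V) i j a :
  j != i -> tnth (tupd x i a) j = tnth x j.
Proof. by rewrite tnth_mktuple => /negbTE ->. Qed.

Lemma tupd_headP n (x : n.+1.-tuple V) a :
  (tnth (tupd x ord0 a) ord0 = a) * (ttail (tupd x ord0 a) = ttail x).
Proof.
split; first exact: tupd_id.
by apply: eq_from_tnth => j; rewrite !tnth_mktuple.
Qed.

Lemma tupd_tailP n (x : n.+1.-tuple V) j a :
  (tnth (tupd x (lift ord0 j) a) ord0 = tnth x ord0)
  * (ttail (tupd x (lift ord0 j) a) = tupd (ttail x) j a).
Proof.
split; first by rewrite tupd_neq.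
by apply: eq_from_tnth => k; rewrite !tnth_mktuple (inj_eq lift_inj).
Qed.

Lemma tupd_lastP n (x : n.+1.-tuple V) a :
  (tnth (tupd x ord_max a) ord_max = a) * (tinit (tupd x ord_max a) = tinit x).
Proof.
split; first exact: tupd_id.
by apply: eq_from_tnth => j; rewrite !tnth_mktuple eq_sym (negbTE (neq_lift _ _)).
Qed.

Lemma tupd_initP n (x : n.+1.-tuple V) j a :
  (tnth (tupd x (lift ord_max j) a) ord_max = tnth x ord_max)
  * (tinit (tupd x (lift ord_max j) a) = tupd (tinit x) j a).
Proof.
split; first by rewrite tupd_neq // neq_lift.
by apply: eq_from_tnth => k; rewrite !tnth_mktuple (inj_eq lift_inj).
Qed.

(* A map of the form (x_0, (x_1, .., x_n)) |-> G x_0 (x_1, .., x_n). *)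
Lemma multilinear_head n (G : V -> n.-tuple V -> W) :
  (forall t, linear (G^~ t)) -> (forall v, multilinear (G v)) ->
  multilinear (fun x : n.+1.-tuple V => G (tnth x ord0) (ttail x)).
Proof.
move=> h1 h2 x i c a b; case: (unliftP ord0 i) => [j|] ->.
  by rewrite !tupd_tailP h2.
by rewrite !tupd_headP h1.
Qed.

Lemma multilinear_last n (G : n.-tuple V -> V -> W) :
  (forall t, linear (G t)) -> (forall v, multilinear (G^~ v)) ->
  multilinear (fun x : n.+1.-tuple V => G (tinit x) (tnth x ord_max)).
Proof.
move=> h1 h2 x i c a b; case: (unliftP ord_max i) => [j|] ->.
  by rewrite !tupd_initP h2.
by rewrite !tupd_lastP h1.
Qed.

Lemma tmerge_tupd n (op : V -> V -> V) (x : n.+1.-tuple V) (m : 'I_n) i :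
  (forall a, linear (op a)) -> (forall a, linear (op^~ a)) ->
  exists2 g : V -> V, linear g &
    exists k, forall a, tmerge op (tupd x i a) m = tupd (tmerge op x m) k (g a).
Proof.
move=> opr opl; set wd := widen_ord (leqnSn n).
have wdE (j : 'I_n) : wd j = j :> nat by [].
have l0E (j : 'I_n) : lift ord0 j = j.+1 :> nat by rewrite lift0.
case: (ltngtP i m) => [im|mi|im].
- have ilt : (i < n)%N := ltn_trans im (ltn_ord m).
  exists id => //; exists (Ordinal ilt) => a.
  apply: eq_from_tnth => j; rewrite !tnth_mktuple -!val_eqE /= /bump /= ?add1n.
  case: ltngtP => [jm|mj|jm]; rewrite ?add0n //.
    by rewrite (gtn_eqF (ltn_trans im (leqW mj))) (gtn_eqF (ltn_trans im mj)).
  by rewrite jm (gtn_eqF im) (gtn_eqF (leqW im)).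
- case: (unliftP ord0 i) mi => [i' -> |->] // mi.
  rewrite l0E ltnS in mi.
  case: (ltngtP m i') mi => [mi _|//|/val_inj mi _].
    exists id => //; exists i' => a.
    apply: eq_from_tnth => j; rewrite !tnth_mktuple.
    rewrite (inj_eq lift_inj) -!val_eqE /= /bump /= ?add1n.
    case: ltngtP => [jm|mj|jm] //.
      by rewrite (ltn_eqF (ltn_trans jm (leqW mi))) (ltn_eqF (ltn_trans jm mi)).
    by rewrite jm (ltn_eqF mi) (ltn_eqF (leqW mi)).
  rewrite -{i'}mi.
  exists (op (tnth x (wd m))) => //; exists m => a.
  apply: eq_from_tnth => j; rewrite !tnth_mktuple.
  rewrite (inj_eq lift_inj) -!val_eqE /= /bump /= ?add1n.
  case: ltngtP => [jm|mj|/val_inj jm] //; first by rewrite (ltn_eqF (leqW jm)).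
  by rewrite jm ltn_eqF.
- have -> : i = wd m by apply: val_inj.
  exists (op^~ (tnth x (lift ord0 m))) => //; exists m => a.
  apply: eq_from_tnth => j; rewrite !tnth_mktuple.
  rewrite -!val_eqE /= /bump /= ?add1n.
  case: ltngtP => [jm|mj|/val_inj jm] //; first by rewrite (gtn_eqF (leqW mj)).
  by rewrite jm gtn_eqF.
Qed.

Lemma multilinear_merge n (op : V -> V -> V) (F : n.-tuple V -> W) (m : 'I_n) :
  (forall a, linear (op a)) -> (forall a, linear (op^~ a)) ->
  multilinear F -> multilinear (fun x => F (tmerge op x m)).
Proof.
move=> opr opl hF x i c a b.
have [g hg [k hk]] := tmerge_tupd x m i opr opl.
by rewrite !hk hg hF.
Qed.

End Multilinear.

(* For z = \sum_k c_k *: (x_k (x) y_k), this is \sum_k c_k *: F x_k y_k. *)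
Definition tsum2 (K : fieldType) (V W : lmodType K) (F : V -> V -> W)
    (z : tpow V 2) : W :=
  tsum (fun t : 2.-tuple V => F (tnth t ord0) (tnth t ord_max)) z.

Section SweedlerTheory.
Variables (K : fieldType) (V W : lmodType K).

Definition bilin (F : V -> V -> W) : Prop :=
  (forall y, linear (F y)) /\ (forall z, linear (F^~ z)).

Lemma bilin_multilinear (F : V -> V -> W) : bilin F ->
  multilinear (fun t : 2.-tuple V => F (tnth t ord0) (tnth t ord_max)).
Proof.
case=> hr hl x i c a b.
have : (i == ord0) || (i == ord_max) by case: i => [[|[|]]].
case/orP => /eqP ->.
  by rewrite !tupd_id !(@tupd_neq _ _ _ _ ord0 ord_max) // hl.
by rewrite !tupd_id !(@tupd_neq _ _ _ _ ord_max ord0) // hr.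
Qed.

Lemma tsum2_linear (F : V -> V -> W) : bilin F -> linear (tsum2 F).
Proof. by move=> /bilin_multilinear; apply: tsum_linear. Qed.

Lemma tsum2_pure (F : V -> V -> W) y z : bilin F ->
  tsum2 F (tpure [tuple y; z]) = F y z.
Proof. by move=> /bilin_multilinear hF; rewrite /tsum2 tsum_pure. Qed.

Lemma tsum2_linearl (F G : V -> V -> W) (c : K) z :
  tsum2 (fun x y => c *: F x y + G x y) z = c *: tsum2 F z + tsum2 G z.
Proof. exact: tsum_linearl. Qed.

Lemma eq_tsum2 (F G : V -> V -> W) z : F =2 G -> tsum2 F z = tsum2 G z.
Proof. by move=> eFG; congr tsum2; apply/funext => x; apply/funext. Qed.

End SweedlerTheory.

HB.mixin Record isBialgebra (K : fieldType) H of GRing.Algebra K H := {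
  comul : {linear H -> tpow H 2};
  counit : {linear H -> K^o};
  comulA : forall x : H,
    tsum2 (fun y z => tsum2 (fun y1 y2 => tpure [tuple y1; y2; z]) (comul y))
      (comul x)
    = tsum2 (fun y z => tsum2 (fun z1 z2 => tpure [tuple y; z1; z2]) (comul z))
        (comul x);
  counitl : forall x : H, tsum2 (fun y z => (counit y : K) *: z) (comul x) = x;
  counitr : forall x : H, tsum2 (fun y z => (counit z : K) *: y) (comul x) = x;
  comul1 : comul 1 = tpure [tuple 1; 1];
  comulM : forall x y : H,
    comul (x * y)
    = tsum2 (fun x1 x2 => tsum2 (fun y1 y2 => tpure [tuple x1 * y1; x2 * y2])
        (comul y)) (comul x);
  counit1 : counit 1 = 1;
  counitM : forall x y : H, counit (x * y) = (counit x : K) * counit y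
}.

#[short(type="bialgType")]
HB.structure Definition Bialgebra (K : fieldType) :=
  {H of isBialgebra K H & GRing.Algebra K H}.

(* Associative algebras, with or without a unit. *)
HB.mixin Record isAssocAlgebra (K : fieldType) A of GRing.Lmodule K A := {
  amul : A -> A -> A;
  amulA : associative amul;
  amul_linearr : forall a, linear (amul a);
  amul_linearl : forall b, linear (amul^~ b)
}.

#[short(type="assocAlgType")]
HB.structure Definition AssocAlgebra (K : fieldType) :=
  {A of isAssocAlgebra K A & GRing.Lmodule K A}.

Notation "a ** b" := (amul a b) (at level 40, left associativity) : ring_scope.

Notation "\sw_ ( y , z <- x ) E" := (tsum2 (fun y z => E) (comul x))
  (at level 41, y name, z name, x at level 50, E at level 41) : ring_scope.

Section Cochains.
Variables (K : fieldType) (H : bialgType K) (A : assocAlgType K).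

Notation EndA := {linear A -> A}.

Definition cochain1 := {linear H -> EndA}.

(* F^n(A) for n >= 2.  For n = 1 this is not F^1(A), which is [cochain1]. *)
Definition cochain (n : nat) : Type :=
  {linear tpow H n -> EndA} * {linear H -> {linear tpow A n -> A}}.

(* The unit of H is not required to act as the identity: as A need not have a
   unit, only the compatibility with the two products is imposed. *)
Definition module_algebra (lam : cochain1) : Prop :=
  (forall x y : H, lam (x * y) = lcomp (lam x) (lam y))
  /\ (forall (x : H) (a b : A),
        lam x (a ** b) = \sw_(y, z <- x) (lam y a ** lam z b)).

(* The map H -> Hom(A^{(x) n}, A) given by x |-> (tpure a |-> G x a). *)
Section Curry.
Variables (n : nat) (G : H -> n.-tuple A -> A).
Hypothesis hG : forall x, multilinear (G x).
Hypothesis hG' : forall a, linear (G^~ a).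

Fact tlift2_linear : linear (fun x => tlift (hG x)).
Proof.
move=> c x y; apply: tpow_ext => a.
by rewrite linD_apply linZ_apply !tlift_pure hG'.
Qed.

Definition tlift2 : {linear H -> {linear tpow A n -> A}} :=
  mk_linear tlift2_linear.

Lemma tlift2_pure x a : tlift2 x (tpure a) = G x a.
Proof. exact: tlift_pure. Qed.

End Curry.

Fact amul_bilin (f : H -> A) (g : H -> A) :
  linear f -> linear g -> bilin (fun y z => f y ** g z).
Proof.
move=> hf hg; split=> [y|z] c a b; first by rewrite hg amul_linearr.
by rewrite hf amul_linearl.
Qed.

Fact sweedler_linear (f : H -> A) (g : H -> A) :
  linear f -> linear g -> linear (fun x => \sw_(y, z <- x) (f y ** g z)).
Proof.
move=> hf hg c x y; rewrite linearP.
exact: (tsum2_linear (amul_bilin hf hg)).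
Qed.

Fact apply_linear (U V : lmodType K) (f : {linear H -> {linear U -> V}}) u :
  linear (fun x => f x u).
Proof. by move=> c x y; rewrite linearP. Qed.

Section Differential.
Variable lam : cochain1.

Section D0.
Variables (n : nat) (phi : {linear tpow H n -> EndA}).

Definition d0_fun (x : n.+1.-tuple H) : EndA :=
  lcomp (lam (tnth x ord0)) (phi (tpure (ttail x)))
  + \sum_(i < n) (-1) ^+ i.+1 *: phi (tpure (tmerge *%R x i))
  + (-1) ^+ n.+1 *: lcomp (phi (tpure (tinit x))) (lam (tnth x ord_max)).

Fact d0_multilinear : multilinear d0_fun.
Proof.
have phi_ml : multilinear (fun x => phi (tpure x)).
  by move=> x i c a b; rewrite tpure_multilinear linearP.
apply: multilinear_add; [apply: multilinear_add|apply: multilinear_scale].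
- apply: (@multilinear_head _ _ _ n (fun v t => lcomp (lam v) (phi (tpure t)))).
    by move=> t c u v; apply: linear_ext => a /=; rewrite linearP.
  move=> v x i c a b; apply: linear_ext => w /=.
  by rewrite phi_ml /= linearP.
- apply: multilinear_sum => i; apply: multilinear_scale.
  apply: (@multilinear_merge _ _ _ n *%R (fun t => phi (tpure t))) => // a c u v.
    by rewrite mulrDr scalerAr.
  by rewrite mulrDl scalerAl.
apply: (@multilinear_last _ _ _ n (fun t v => lcomp (phi (tpure t)) (lam v))).
  by move=> t c u v; apply: linear_ext => a /=; rewrite !linearP.
move=> v x i c a b; apply: linear_ext => w /=.
by rewrite phi_ml.
Qed.

Definition d0 : {linear tpow H n.+1 -> EndA} := tlift d0_multilinear.

Lemma d0_pure x : d0 (tpure x) = d0_fun x.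
Proof. exact: tlift_pure. Qed.

End D0.

Section D1.
Variables (n : nat) (phi : {linear H -> {linear tpow A n -> A}}).

Definition d1_fun (x : H) (a : n.+1.-tuple A) : A :=
  \sw_(y, z <- x) (lam y (tnth a ord0) ** phi z (tpure (ttail a)))
  + \sum_(i < n) (-1) ^+ i.+1 *: phi x (tpure (tmerge amul a i))
  + (-1) ^+ n.+1 *:
      \sw_(y, z <- x) (phi y (tpure (tinit a)) ** lam z (tnth a ord_max)).

Fact d1_multilinear x : multilinear (d1_fun x).
Proof.
have phi_ml y : multilinear (fun a => phi y (tpure a)).
  by move=> a i c u v; rewrite tpure_multilinear linearP.
apply: multilinear_add; [apply: multilinear_add|apply: multilinear_scale].
- apply: (@multilinear_head _ _ _ n
    (fun v t => \sw_(y, z <- x) (lam y v ** phi z (tpure t)))).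
    move=> t c u v; rewrite -tsum2_linearl; apply: eq_tsum2 => y z.
    by rewrite linearP amul_linearl.
  move=> v t i c u w; rewrite -tsum2_linearl; apply: eq_tsum2 => y z.
  by rewrite phi_ml amul_linearr.
- apply: multilinear_sum => i; apply: multilinear_scale.
  apply: (@multilinear_merge _ _ _ n amul (fun t => phi x (tpure t))) => //.
    exact: amul_linearr.
  exact: amul_linearl.
apply: (@multilinear_last _ _ _ n
  (fun t v => \sw_(y, z <- x) (phi y (tpure t) ** lam z v))).
  move=> t c u v; rewrite -tsum2_linearl; apply: eq_tsum2 => y z.
  by rewrite linearP amul_linearr.
move=> v t i c u w; rewrite -tsum2_linearl; apply: eq_tsum2 => y z.
by rewrite phi_ml amul_linearl.
Qed.

Fact d1_linear a : linear (d1_fun^~ a).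
Proof.
have sw1 := sweedler_linear (apply_linear lam (tnth a ord0))
  (apply_linear phi (tpure (ttail a))).
have sw2 := sweedler_linear (apply_linear phi (tpure (tinit a)))
  (apply_linear lam (tnth a ord_max)).
move=> c x y; rewrite /d1_fun sw1 sw2 !scalerDr !scalerA [c * _]mulrC.
set s := \sum_(i < n) _; set sx := \sum_(i < n) _; set sy := \sum_(i < n) _.
have -> : s = c *: sx + sy.
  rewrite /s /sx /sy scaler_sumr -big_split; apply: eq_bigr => i _ /=.
  by rewrite linearP linD_apply linZ_apply scalerDr !scalerA mulrC.
by rewrite (addrACA _ _ (c *: sx) sy); apply: addrACA.
Qed.

Definition d1 : {linear H -> {linear tpow A n.+1 -> A}} :=
  tlift2 d1_multilinear d1_linear.

Lemma d1_pure x a : d1 x (tpure a) = d1_fun x a.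
Proof. exact: tlift2_pure. Qed.

End D1.

Definition differential (n : nat) (phi : cochain n) : cochain n.+1 :=
  (d0 phi.1, d1 phi.2).

End Differential.

Section Cup.
Variables f g : cochain1.

Definition cup0_fun (x : 2.-tuple H) : EndA :=
  lcomp (f (tnth x ord0)) (g (tnth x ord_max)).

Fact cup0_multilinear : multilinear cup0_fun.
Proof.
apply: (bilin_multilinear (F := fun y z => lcomp (f y) (g z))).
split=> [y|z] c u v; apply: linear_ext => a /=; last by rewrite linearP.
by rewrite [g _]linearP /= linearP.
Qed.

Definition cup1_fun (x : H) (a : 2.-tuple A) : A :=
  \sw_(y, z <- x) (f y (tnth a ord0) ** g z (tnth a ord_max)).

Fact cup1_multilinear x : multilinear (cup1_fun x).
Proof.
apply: (bilin_multilinear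
  (F := fun a b => \sw_(y, z <- x) (f y a ** g z b))).
split=> [a|b] c u v; rewrite -tsum2_linearl; apply: eq_tsum2 => y z.
  by rewrite linearP amul_linearr.
by rewrite linearP amul_linearl.
Qed.

Fact cup1_linear a : linear (cup1_fun^~ a).
Proof. exact: sweedler_linear (apply_linear _ _) (apply_linear _ _). Qed.

Definition cup : cochain 2 :=
  (tlift cup0_multilinear, tlift2 cup1_multilinear cup1_linear).

Lemma cup0_pure x y : cup.1 (tpure [tuple x; y]) = lcomp (f x) (g y).
Proof. exact: tlift_pure. Qed.

Lemma cup1_pure x a b :
  cup.2 x (tpure [tuple a; b]) = \sw_(y, z <- x) (f y a ** g z b).
Proof. exact: tlift2_pure. Qed.

End Cup.

(* A deformation \sum_(i <= N) L_i t^i of order N, given by its coefficients. *)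
Definition deformation (lam : cochain1) (N : nat) (L : 'I_N.+1 -> cochain1) :
    Prop :=
  [/\ L ord0 = lam,
      forall (n : 'I_N.+1) (x y : H),
        L n (x * y)
        = \sum_(p : 'I_N.+1 * 'I_N.+1 | (p.1 + p.2 == n)%N)
            lcomp (L p.1 x) (L p.2 y)
    & forall (n : 'I_N.+1) (x : H) (a b : A),
        L n x (a ** b)
        = \sw_(y, z <- x)
            \sum_(p : 'I_N.+1 * 'I_N.+1 | (p.1 + p.2 == n)%N)
              (L p.1 y a ** L p.2 z b)].

Definition obstruction (N : nat) (L : 'I_N.+1 -> cochain1) : cochain 2 :=
  \sum_(1 <= i < N.+1) cup (L (inord i)) (L (inord (N.+1 - i))).

End Cochains.

(* Main.v *)
(** Put M_n(x, y) = \sum_(i + j = n) L_i(x) L_j(y) for indices at most N.  Then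
    M_n(x, y) = L_n(x y) for n <= N by the deformation equations, while
    M_(N+1) = Ob.  Associativity (for the second component, coassociativity and
    associativity) makes both
      \sum_(i + m = N+1) L_i(x) M_m(y, z)  and  \sum_(m + k = N+1) M_m(x, y) L_k(z)
    equal to the sum of the L_i(x) L_j(y) L_k(z) over i + j + k = N+1.
    Substituting the two descriptions of M_m, the difference of the two sides
    is d Ob. *)
Require Import Defs.
From HB Require Import structures.
From mathcomp Require Import freeg.
From mathcomp Require Import all_boot all_algebra.

Set Implicit Arguments.
Unset Strict Implicit.
Unset Printing Implicit Defensive.

Import GRing.Theory.
Local Open Scope ring_scope.

(** * Sums over index pairs and triples of total N+1 *)

Section TripleSums.
Variables (V : zmodType) (N : nat).
Notation I := 'I_N.+1.

(** Indices at most N with total N+1 are automatically at least 1, so the bounded pairs are exactly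
    those occurring in [Ob], and [inord] never leaves its range. *)
Lemma big_nat_antidiagonal (F : I -> I -> V) :
  \sum_(1 <= i < N.+1) F (inord i) (inord (N.+1 - i))
  = \sum_(p : I * I | (p.1 + p.2 == N.+1)%N) F p.1 p.2.
Proof.
rewrite -(pair_big_dep predT (fun i j : I => (i + j == N.+1)%N) F) /=.
rewrite big_ord_recl /= [X in _ = X + _]big1 ?add0r; last first.
  by move=> j /eqP jN; have := ltn_ord j; rewrite add0n in jN; rewrite jN ltnn.
rewrite big_add1 /= big_mkord; apply: eq_bigr => i _.
have -> : inord i.+1 = lift ord0 i :> I.
  by apply: val_inj; rewrite /= inordK ?ltnS.
have ltN : (N.+1 - i.+1 < N.+1)%N by rewrite subSS ltnS leq_subr.
apply/esym/big_pred1 => j; rewrite /= -val_eqE /= inordK // /bump /= add1n.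
by rewrite -(eqn_add2l i.+1 j) subnKC // ltnS ltnW.
Qed.

(** Grouping a triple as i + (j + k) needs m = j + k to be an index at most N, which holds exactly
    when i is positive. The first sum supplies the missing case i = 0, where m would be N+1. *)
Lemma sum_antidiagonal_split (T : I -> I -> I -> V) :
  \sum_(p : I * I | (p.1 + p.2 == N.+1)%N) T ord0 p.1 p.2
  + \sum_(p : I * I | (p.1 + p.2 == N.+1)%N)
      \sum_(q : I * I | (q.1 + q.2 == p.2)%N) T p.1 q.1 q.2
  = \sum_(i : I) \sum_(j : I) \sum_(k : I | (i + j + k == N.+1)%N) T i j k.
Proof.
rewrite -(pair_big_dep predT (fun i m : I => (i + m == N.+1)%N)
  (fun i m => \sum_(q : I * I | (q.1 + q.2 == m)%N) T i q.1 q.2)) /=.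
rewrite [in RHS]big_ord_recl [X in _ + X]big_ord_recl /=.
rewrite [X in _ + (X + _)]big1 ?add0r; last first.
  by move=> j /eqP jN; have := ltn_ord j; rewrite add0n in jN; rewrite jN ltnn.
congr (_ + _).
  by rewrite -(pair_big_dep predT (fun j k : I => (j + k == N.+1)%N) (T ord0)).
apply: eq_bigr => i _.
have ltN : (N - i < N.+1)%N by rewrite ltnS leq_subr.
(* The outer index is now i+1, which leaves m = N+1 - (i+1) = N - i. *)
rewrite (big_pred1 (Ordinal ltN)); last first.
  move=> m; rewrite /= -val_eqE /= /bump /= add1n.
  by rewrite -(eqn_add2l i.+1 m) !addSn subnKC // ltnW.
rewrite -(pair_big_dep predT (fun j k : I => (j + k == N - i)%N)
  (T (lift ord0 i))) /=.
apply: eq_bigr => j _; apply: eq_bigl => k; rewrite /bump /= add1n.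
by rewrite -(eqn_add2l i (j + k)) subnKC ?(ltnW (ltn_ord i)) // !addSn eqSS addnA.
Qed.

(** The four sums have the shape of the four terms of d Ob. The first and third recombine into the
    sum of [T] over all triples of total N+1; so do the second and fourth, by the same splitting
    with the triple read backwards. *)
Lemma sum_antidiagonal_cocycle (T : I -> I -> I -> V) :
  \sum_(p : I * I | (p.1 + p.2 == N.+1)%N) T ord0 p.1 p.2
  - \sum_(p : I * I | (p.1 + p.2 == N.+1)%N)
      \sum_(q : I * I | (q.1 + q.2 == p.1)%N) T q.1 q.2 p.2
  + \sum_(p : I * I | (p.1 + p.2 == N.+1)%N)
      \sum_(q : I * I | (q.1 + q.2 == p.2)%N) T p.1 q.1 q.2
  - \sum_(p : I * I | (p.1 + p.2 == N.+1)%N) T p.1 p.2 ord0 = 0.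
Proof.
have swapK : involutive (fun p : I * I => (p.2, p.1)) by case.
apply/eqP; rewrite subr_eq0 addrAC subr_eq; apply/eqP.
rewrite sum_antidiagonal_split.
(* Reversing the pairs puts the distinguished last index first, as the splitting lemma expects. *)
rewrite [X in _ = X + _](reindex_inj (inv_inj swapK)) /=.
rewrite [X in _ = _ + X](reindex_inj (inv_inj swapK)) /=.
under [X in _ = X + _]eq_bigl do rewrite addnC.
under [X in _ = _ + X]eq_bigl do rewrite addnC.
under [X in _ = _ + X]eq_bigr => p _.
  rewrite (reindex_inj (inv_inj swapK)) /=.
  under eq_bigl do rewrite addnC.
  over.
rewrite (sum_antidiagonal_split (fun k j i => T i j k)).
rewrite exchange_big [RHS]exchange_big /=; apply: eq_bigr => j _.
under eq_bigr do rewrite big_mkcond.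
under [RHS]eq_bigr do rewrite big_mkcond.
rewrite exchange_big /=; apply: eq_bigr => k _; apply: eq_bigr => i _.
by rewrite addnC (addnC i) addnA.
Qed.

End TripleSums.

(** * Linearity and coassociativity for Sweedler sums *)

Lemma tsum_sum (K : fieldType) (V W : lmodType K) n (J : Type) (r : seq J)
    (P : pred J) (F : J -> n.-tuple V -> W) z :
  tsum (fun x => \sum_(j <- r | P j) F j x) z = \sum_(j <- r | P j) tsum (F j) z.
Proof.
have tsum0 : tsum (fun _ : n.-tuple V => 0 : W) z = 0.
  have := tsum_linearl 1 (fun _ : n.-tuple V => 0 : W) (fun=> 0) z.
  rewrite scaler0 addr0 scale1r => h.
  (* Here [h] says s = s + s, which forces s = 0. *)
  by apply: (addrI (tsum (fun _ : n.-tuple V => 0 : W) z)); rewrite addr0 -h.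
elim: r => [|j r IH].
  by rewrite big_nil -[RHS]tsum0; congr tsum; apply/boolp.funext => x; rewrite big_nil.
rewrite big_cons -IH; case: ifP => Pj; last first.
  by congr tsum; apply/boolp.funext => x; rewrite big_cons Pj.
rewrite -[tsum (F j) z]scale1r -tsum_linearl.
by congr tsum; apply/boolp.funext => x; rewrite big_cons Pj scale1r.
Qed.

(** The representative [repr z] does not depend on the map being summed, so both sides run over the
    same finite combination of tuples, and [g] distributes over it. *)
Lemma linear_tsum (K : fieldType) (V W X : lmodType K) n
    (g : {linear W -> X}) (F : n.-tuple V -> W) z :
  g (tsum F z) = tsum (g \o F) z.
Proof.
rewrite /tsum -[repr z]freeg_sumE.
pose lin (Y : lmodType K) (h : n.-tuple V -> Y) :
  {linear {freeg (n.-tuple V) / K} -> Y} := mk_linear (fglift_linear h).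
rewrite -[fglift F _]/(lin _ F _) -[RHS]/(lin _ (g \o F) _) !linear_sum.
apply: eq_bigr => x _.
rewrite -[lin _ F _]/(fglift _ _) -[RHS]/(fglift _ _).
by rewrite !liftU linearZ.
Qed.

Section Sweedler.
Variables (K : fieldType).

Lemma tsum2_sum (V W : lmodType K) (J : Type) (r : seq J) (P : pred J)
    (F : J -> V -> V -> W) z :
  tsum2 (fun x y => \sum_(j <- r | P j) F j x y) z
  = \sum_(j <- r | P j) tsum2 (F j) z.
Proof. exact: tsum_sum. Qed.

Lemma linear_tsum2 (V W X : lmodType K) (g : {linear W -> X})
    (F : V -> V -> W) z :
  g (tsum2 F z) = tsum2 (fun x y => g (F x y)) z.
Proof. exact: linear_tsum. Qed.

(** A trilinear [F] factors through a linear map on the third tensor power; applying that map to the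
    coassociativity axiom gives the identity. *)
Lemma comulA_trilinear (H : bialgType K) (W : lmodType K) (F : H -> H -> H -> W) x :
  (forall u v, linear (F u v)) -> (forall u w, linear (fun v => F u v w)) ->
  (forall v w, linear (fun u => F u v w)) ->
  \sw_(y, z <- x) (\sw_(y1, y2 <- y) F y1 y2 z)
  = \sw_(y, z <- x) (\sw_(z1, z2 <- z) F y z1 z2).
Proof.
move=> F3 F2 F1.
(* Reading the last two entries through [ttail] reduces multilinearity to linearity in the head and
   bilinearity in the rest. *)
pose G (t : 3.-tuple H) :=
  F (tnth t ord0) (tnth (ttail t) ord0) (tnth (ttail t) ord_max).
have G_ml : multilinear G.
  apply: (@multilinear_head _ _ _ 2
    (fun u t => F u (tnth t ord0) (tnth t ord_max))) => // u.
  exact: bilin_multilinear.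
have GE u v w : tlift G_ml (tpure [tuple u; v; w]) = F u v w.
  by rewrite tlift_pure /G !tnth_mktuple.
have := congr1 (tlift G_ml) (comulA x); rewrite !linear_tsum2.
under eq_tsum2 do rewrite linear_tsum2.
under [in RHS]eq_tsum2 do rewrite linear_tsum2.
under eq_tsum2 do under eq_tsum2 do rewrite GE.
by under [in RHS]eq_tsum2 do under eq_tsum2 do rewrite GE.
Qed.

End Sweedler.

(** * Faces of a triple *)

Lemma tuple3P T (t : 3.-tuple T) : exists x y z, t = [tuple x; y; z].
Proof.
case: t => [[|x [|y [|z [|]]]]] // st; exists x, y, z; exact: val_inj.
Qed.

Section TernaryTuples.
Variables (T : Type) (op : T -> T -> T) (x y z : T).

Lemma ttail3 : ttail [tuple x; y; z] = [tuple y; z].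
Proof.
by apply: eq_from_tnth => -[[|[|]]] // i; rewrite tnth_mktuple !(tnth_nth x).
Qed.

Lemma tinit3 : tinit [tuple x; y; z] = [tuple x; y].
Proof.
by apply: eq_from_tnth => -[[|[|]]] // i; rewrite tnth_mktuple !(tnth_nth x).
Qed.

Lemma tmerge3_0 : tmerge op [tuple x; y; z] ord0 = [tuple op x y; z].
Proof.
by apply: eq_from_tnth => -[[|[|]]] // i; rewrite tnth_mktuple !(tnth_nth x).
Qed.

Lemma tmerge3_1 : tmerge op [tuple x; y; z] ord_max = [tuple x; op y z].
Proof.
by apply: eq_from_tnth => -[[|[|]]] // i; rewrite tnth_mktuple !(tnth_nth x).
Qed.

End TernaryTuples.

(** * The differential in degree 2 and its value on the obstruction *)

Section Cochains.
Variables (K : fieldType) (H : bialgType K) (A : assocAlgType K).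
Variable lam : cochain1 H A.

Lemma amul_sumr (J : Type) (r : seq J) (P : pred J) (F : J -> A) (a : A) :
  a ** (\sum_(j <- r | P j) F j) = \sum_(j <- r | P j) (a ** F j).
Proof. exact: (linear_sum (mk_linear (amul_linearr a))). Qed.

Lemma amul_suml (J : Type) (r : seq J) (P : pred J) (F : J -> A) (a : A) :
  (\sum_(j <- r | P j) F j) ** a = \sum_(j <- r | P j) (F j ** a).
Proof. exact: (linear_sum (mk_linear (amul_linearl a))). Qed.

Lemma amul_tsum2r (V : lmodType K) (F : V -> V -> A) z (a : A) :
  a ** tsum2 F z = tsum2 (fun u v => a ** F u v) z.
Proof. exact: (linear_tsum2 (mk_linear (amul_linearr a))). Qed.

Lemma amul_tsum2l (V : lmodType K) (F : V -> V -> A) z (a : A) :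
  tsum2 F z ** a = tsum2 (fun u v => F u v ** a) z.
Proof. exact: (linear_tsum2 (mk_linear (amul_linearl a))). Qed.

(** The zero-based merge positions 0 and 1 carry the signs of exponents 1 and 2, and the last term
    that of exponent 3, so the signs alternate. *)
Lemma d0_pure3 (phi : {linear tpow H 2 -> {linear A -> A}}) x y z (a : A) :
  d0 lam phi (tpure [tuple x; y; z]) a
  = lam x (phi (tpure [tuple y; z]) a) - phi (tpure [tuple x * y; z]) a
    + phi (tpure [tuple x; y * z]) a - phi (tpure [tuple x; y]) (lam z a).
Proof.
rewrite d0_pure /d0_fun big_ord_recl big_ord1 ttail3 tinit3.
rewrite tmerge3_0 (_ : lift ord0 ord0 = ord_max) ?tmerge3_1; last exact: val_inj.
rewrite !expr1 sqrrN expr1n exprS sqrrN expr1n mulr1 !scaleN1r scale1r.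
by rewrite !linD_apply !linN_apply /= addrA !(tnth_nth x).
Qed.

Lemma d1_pure3 (phi : {linear H -> {linear tpow A 2 -> A}}) x (a b c : A) :
  d1 lam phi x (tpure [tuple a; b; c])
  = \sw_(y, z <- x) (lam y a ** phi z (tpure [tuple b; c]))
    - phi x (tpure [tuple a ** b; c]) + phi x (tpure [tuple a; b ** c])
    - \sw_(y, z <- x) (phi y (tpure [tuple a; b]) ** lam z c).
Proof.
rewrite d1_pure /d1_fun big_ord_recl big_ord1 ttail3 tinit3.
rewrite tmerge3_0 (_ : lift ord0 ord0 = ord_max) ?tmerge3_1; last exact: val_inj.
rewrite !expr1 sqrrN expr1n exprS sqrrN expr1n mulr1 !scaleN1r scale1r.
by rewrite addrA !(tnth_nth a).
Qed.

Section Obstruction.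
Variables (N : nat) (L : 'I_N.+1 -> cochain1 H A).
Notation I := 'I_N.+1.

Lemma obstruction0_pure x y (a : A) :
  (obstruction L).1 (tpure [tuple x; y]) a
  = \sum_(p : I * I | (p.1 + p.2 == N.+1)%N) L p.1 x (L p.2 y a).
Proof.
rewrite /obstruction (big_nat_antidiagonal (fun i j => cup (L i) (L j))).
rewrite (raddf_sum fst) !lin_sum_apply.
by apply: eq_bigr => p _; rewrite cup0_pure.
Qed.

Lemma obstruction1_pure x (a b : A) :
  (obstruction L).2 x (tpure [tuple a; b])
  = \sum_(p : I * I | (p.1 + p.2 == N.+1)%N)
      \sw_(y, z <- x) (L p.1 y a ** L p.2 z b).
Proof.
rewrite /obstruction (big_nat_antidiagonal (fun i j => cup (L i) (L j))).
rewrite (raddf_sum snd) !lin_sum_apply.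
by apply: eq_bigr => p _; rewrite cup1_pure.
Qed.

Hypothesis L_deformation : deformation lam L.

Lemma d0_obstruction : d0 lam (obstruction L).1 = 0.
Proof.
have [L0 LM _] := L_deformation.
apply: tpow_ext => t; have [x [y [z ->]]] := tuple3P t; apply: linear_ext => a.
rewrite d0_pure3 !obstruction0_pure linear_sum -L0.
(* With [lam] written as [L ord0], the outer terms are already sums of this triple product. The two
   inner ones become so by the deformation equation, available since p.1 and p.2 are at most N. *)
rewrite -[RHS](sum_antidiagonal_cocycle
  (fun i j k => L i x (L j y (L k z a)))).
congr (_ - _ + _ - _); apply: eq_bigr => p _.
  by rewrite LM lin_sum_apply.
by rewrite LM lin_sum_apply linear_sum.
Qed.

Lemma d1_obstruction : d1 lam (obstruction L).2 = 0.
Proof.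
have [L0 _ LM] := L_deformation.
apply: linear_ext => x; apply: tpow_ext => t.
have [a [b [c ->]]] := tuple3P t.
(* Normal form of a triple term: the second Sweedler leg is split again and the product is bracketed
   to the right. *)
pose T (i j k : I) :=
  \sw_(y, z <- x) (\sw_(u, v <- z) (L i y a ** (L j u b ** L k v c))).
(* Terms that split the first leg reach the normal form by coassociativity of H and associativity of
   A; these are the second and fourth terms of the differential. *)
have TE i j k :
  \sw_(y, z <- x) (\sw_(u, v <- y) (L i u a ** L j v b ** L k z c)) = T i j k.
  rewrite (@comulA_trilinear _ _ _ (fun u v z => L i u a ** L j v b ** L k z c)).
  - by apply: eq_tsum2 => y z; apply: eq_tsum2 => u v; rewrite amulA.
  - by move=> u v d w w'; rewrite linearP amul_linearr.
  - by move=> u w d v v'; rewrite linearP amul_linearr amul_linearl.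
  - by move=> v w d u u'; rewrite linearP !amul_linearl.
rewrite d1_pure3 !obstruction1_pure -L0.
rewrite -[RHS](sum_antidiagonal_cocycle T); congr (_ - _ + _ - _).
- rewrite -tsum2_sum; apply: eq_tsum2 => y z.
  rewrite obstruction1_pure amul_sumr; apply: eq_bigr => p _.
  by rewrite amul_tsum2r.
- apply: eq_bigr => p _; under [RHS]eq_bigr do rewrite -TE.
  rewrite -tsum2_sum; apply: eq_tsum2 => y z.
  rewrite LM amul_tsum2l -tsum2_sum; apply: eq_tsum2 => u v.
  exact: amul_suml.
(* Expanding the action on b ** c splits the second leg, so this term is in normal form directly. *)
- apply: eq_bigr => p _; rewrite -tsum2_sum; apply: eq_tsum2 => y z.
  rewrite LM amul_tsum2r -tsum2_sum; apply: eq_tsum2 => u v.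
  exact: amul_sumr.
- under [RHS]eq_bigr do rewrite -TE.
  rewrite -tsum2_sum; apply: eq_tsum2 => y z.
  rewrite obstruction1_pure amul_suml; apply: eq_bigr => p _.
  by rewrite amul_tsum2l.
Qed.

End Obstruction.

End Cochains.

Theorem lemma4p3 (K : fieldType) (H : bialgType K) (A : assocAlgType K)
    (lam : cochain1 H A) (lam_action : module_algebra lam)
    (N : nat) (N_ge1 : (1 <= N)%N) (L : 'I_N.+1 -> cochain1 H A)
    (L_deformation : deformation lam L) :
  differential lam (obstruction L) = 0 :> cochain H A 3.
Proof.
by rewrite /differential d0_obstruction // d1_obstruction.
Qed.
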